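(* Let $\mathrm{OPT}(d)$ be the minimum size of a hub labeling of the $d$-dimensional hypercube $Q_d$. Then $\mathrm{OPT}(d)=(2.5+o(1))^d$ as $d\to\infty$. *)

(* Defs.v *)
From mathcomp Require Import all_boot.
Set Implicit Arguments. Unset Strict Implicit. Unset Printing Implicit Defensive.

(* Vertices of the d-dimensional hypercube Q_d: subsets of {0,..,d-1}
   (equivalently 0/1-vectors of length d). Two vertices are adjacent iff
   they differ in exactly one coordinate, so the shortest-path distance in
   Q_d is the Hamming distance = size of the symmetric difference. *)
Definition qvert (d : nat) := {set 'I_d}.

Definition qdist (d : nat) (u v : qvert d) : nat := #|(u :\: v) :|: (v :\: u)|.

Definition on_geodesic (d : nat) (u w v : qvert d) : bool :=
  qdist u w + qdist w v == qdist u v.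

Definition is_hub_labeling (d : nat) (H : {ffun qvert d -> {set qvert d}}) : bool :=
  [forall u : qvert d, forall v : qvert d,
     [exists w in H u :&: H v, on_geodesic u w v]].

Definition hl_size (d : nat) (H : {ffun qvert d -> {set qvert d}}) : nat :=
  \sum_(v : qvert d) #|H v|.

(* OPT(d): minimum size of a hub labeling of Q_d.  The neutral element
   #|qvert d|^2 is the size of the (valid) full labeling H v = setT, so
   it never lies below the true minimum. *)
Definition OPT (d : nat) : nat :=
  \big[minn/(#|qvert d| ^ 2)]_(H : {ffun qvert d -> {set qvert d}} | is_hub_labeling H)
     hl_size H.

(* Main.v *)
Require Import Defs.
From Stdlib Require Import Reals Lra.
From Coquelicot Require Import Coquelicot.
From mathcomp Require Import all_boot zify.
Set Implicit Arguments. Unset Strict Implicit. Unset Printing Implicit Defensive.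

(** Lower bound: for 2k <= d, every pair u, v at distance 2k has a common hub w
    on a geodesic, and w is at distance at least k from u or from v.  A hub w of
    u with |u - w| >= k serves at most C(d-k,k) vertices v in this way, so
    2^d C(d,2k) <= 2 C(d-k,k) |H|, that is, |H| >= 2^d C(d,k) / (2 C(2k,k)).
    Since C(2k,k) <= 4^k, and the largest term C(d,k) 4^(-k) of the expansion of
    (1 + 1/4)^d has 2k <= d, this is (5/2)^d up to a polynomial factor.

    Upper bound: for each t, a pair at distance t has C(t, t/2) geodesic
    midpoints, so greedy covering gives a set S_t of about
    d 2^d / C(t, t/2) ~ 2^(d-t) vertices that contains a midpoint of every such
    pair.  Let the hubs of u be the vertices of S_t at distance t/2 (rounded
    down or up) from u, for all t.  The total size is polynomially close to the
    sum of 2^d C(d,k) 4^(-k), with t = 2k. *)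

Local Open Scope nat_scope.

(** * Symmetric differences of finite sets *)

Definition sdiff (T : finType) (A B : {set T}) : {set T} := (A :\: B) :|: (B :\: A).

Lemma in_sdiff (T : finType) (A B : {set T}) x :
  (x \in sdiff A B) = (x \in A) (+) (x \in B).
Proof. by rewrite !inE; case: (x \in A); case: (x \in B). Qed.

Lemma sdiffC (T : finType) (A B : {set T}) : sdiff A B = sdiff B A.
Proof. by apply/setP=> x; rewrite !in_sdiff addbC. Qed.

Lemma sdiffK (T : finType) (A : {set T}) : involutive (sdiff A).
Proof. by move=> B; apply/setP=> x; rewrite !in_sdiff addKb. Qed.

Lemma sdiff_inj (T : finType) (A : {set T}) : injective (sdiff A).
Proof. exact: can_inj (sdiffK A). Qed.

Lemma sdiff_trans (T : finType) (A B C : {set T}) :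
  sdiff (sdiff A B) (sdiff A C) = sdiff B C.
Proof.
apply/setP=> x; rewrite !in_sdiff.
by case: (x \in A); case: (x \in B); case: (x \in C).
Qed.

Lemma card_sdiff (T : finType) (A B : {set T}) :
  #|sdiff A B| = #|A :\: B| + #|B :\: A|.
Proof.
rewrite cardsU; suff -> : (A :\: B) :&: (B :\: A) = set0 by rewrite cards0 subn0.
by apply/setP=> x; rewrite !inE; case: (x \in A); case: (x \in B).
Qed.

(** * Distances, geodesics and their counts in the hypercube *)

Section Distance.
Variable d : nat.
Implicit Types u v w : qvert d.

Lemma qdistE u v : qdist u v = #|sdiff u v|. Proof. by []. Qed.

Lemma qdistC u v : qdist u v = qdist v u.
Proof. by rewrite !qdistE sdiffC. Qed.

Lemma qdist_le u v : qdist u v <= d.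
Proof. by rewrite -[X in _ <= X]card_ord max_card. Qed.

Lemma card_qvert : #|{: qvert d}| = 2 ^ d.
Proof. by rewrite -cardsT -powersetT card_powerset cardsT card_ord. Qed.

Lemma on_geodesicC u w v : on_geodesic u w v = on_geodesic v w u.
Proof.
by rewrite /on_geodesic addnC (qdistC w v) (qdistC u w) (qdistC u v).
Qed.

(** With [A = sdiff u w] and [B = sdiff u v], the excess [#|A| + #|sdiff A B| - #|B|] equals twice
    [#|A :\: B|], so it vanishes exactly when [A] lies in [B]. *)
Lemma on_geodesicE u w v : on_geodesic u w v = (sdiff u w \subset sdiff u v).
Proof.
rewrite /on_geodesic !qdistE -(sdiff_trans u w v).
move: (sdiff u w) (sdiff u v) => A B; rewrite card_sdiff.
rewrite -(cardsID B A) -(cardsID A B) (setIC B A) -setD_eq0 -cards_eq0.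
by apply/eqP/eqP; lia.
Qed.

Lemma card_sphere u k : #|[set w : qvert d | qdist u w == k]| = 'C(d, k).
Proof.
rewrite -[in RHS](card_ord d) -card_draws.
rewrite -(card_imset _ (@sdiff_inj _ u)); apply: eq_card => w.
apply/imsetP/idP => [[x] | ].
  by rewrite !inE qdistE => /eqP <- ->.
by rewrite inE => ww; exists (sdiff u w); rewrite ?sdiffK // inE qdistE sdiffK.
Qed.

Lemma card_geodesic u v k : 
  #|[set w | on_geodesic u w v && (qdist u w == k)]| = 'C(qdist u v, k).
Proof.
rewrite qdistE -cards_draws -(card_imset _ (@sdiff_inj _ u)).
apply: eq_card => w; apply/imsetP/idP => [[x] | ].
  by rewrite !inE on_geodesicE qdistE => xP ->.
rewrite inE => ww; exists (sdiff u w); rewrite ?sdiffK //.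
by rewrite inE on_geodesicE qdistE sdiffK.
Qed.

(** Let [j = qdist u w]. Beyond [w] a geodesic only flips coordinates outside [sdiff u w], so [v] is
    determined by [k.*2 - j] of the other [d - j] coordinates. This count is largest at [j = k]. *)
Lemma card_beyond u w k : k <= qdist u w -> k.*2 <= d ->
  #|[set v | on_geodesic u w v && (qdist u v == k.*2)]| <= 'C(d - k, k).
Proof.
move=> kj kd; set S := [set _ | _].
have [->|[v0]] := set_0Vmem S; first by rewrite cards0.
rewrite inE => /andP[/eqP geo0 /eqP dist0].
have j2k : qdist u w <= k.*2 by rewrite -dist0 -geo0 leq_addr.
apply: (@leq_trans 'C(d - qdist u w, k.*2 - qdist u w)).
  have cC : #|~: sdiff u w| = d - qdist u w.
    by rewrite cardsCs setCK card_ord.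
  rewrite -cC -cards_draws -(card_imset _ (@sdiff_inj _ w)).
  apply/subset_leq_card/subsetP => _ /imsetP[v + ->].
  rewrite !inE => /andP[geo /eqP dist]; apply/andP; split; last first.
    by move/eqP: geo; rewrite dist (qdistE w v); move=> <-; rewrite addKn.
  move: geo; rewrite on_geodesicE => /subsetP sub.
  apply/subsetP => x; move: (sub x); rewrite in_setC !in_sdiff.
  by case: (x \in u); case: (x \in v); case: (x \in w) => // /(_ isT).
(* Complementing makes both lower indices [d - k.*2], so monotonicity in the upper index
   suffices. *)
rewrite -bin_sub; last by lia.
have -> : d - qdist u w - (k.*2 - qdist u w) = d - k.*2 by lia.
rewrite -[X in _ <= X]bin_sub; last by lia.
have -> : d - k - k = d - k.*2 by lia.
apply: leq_bin2l; lia.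
Qed.

End Distance.

(** * Binomial estimates *)

Lemma bin_le_exp2 n k : 'C(n, k) <= 2 ^ n.
Proof.
have [kn|/bin_small -> //] := leqP k n.
have := Pascal 1 1 n; rewrite (bigD1 (Ordinal (kn : k < n.+1))) //= => ->.
by rewrite !exp1n !muln1 leq_addr.
Qed.

Lemma bin_double_succ k : k.+1 * 'C(k.+1.*2, k.+1) = 2 * k.*2.+1 * 'C(k.*2, k).
Proof.
have e1 : 'C(k.+1.*2, k.+1) = 2 * 'C(k.*2.+1, k).
  by rewrite doubleS binS -[in 'C(_, k.+1)]bin_sub; 
     [rewrite (_ : k.*2.+1 - k.+1 = k); lia | lia].
have := mul_bin_down k.*2.+1 k; rewrite /= e1.
by rewrite (_ : k.*2.+1 - k = k.+1); [nia | lia].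
Qed.

Lemma exp4_le_bin k : 4 ^ k <= k.*2.+1 * 'C(k.*2, k).
Proof.
elim: k => [|k IH] //.
have e := bin_double_succ k; rewrite expnS.
rewrite -(leq_pmul2l (ltn0Sn k)) [X in _ <= X]mulnCA e.
have : k.+1 * (4 * 4 ^ k) <= k.+1 * (4 * (k.*2.+1 * 'C(k.*2, k))).
  by rewrite !leq_pmul2l.
move=> /leq_trans; apply; rewrite doubleS; nia.
Qed.

(** Even [t] is the central binomial bound; for odd [t] the leading factor 2 pays for the extra
    power of 2. *)
Lemma exp2_le_bin_half t : 2 ^ t <= 2 * t.+1 * 'C(t, t./2).
Proof.
rewrite -{1 2 3}(odd_double_half t); set k := t./2.
have e4 : 2 ^ k.*2 = 4 ^ k by rewrite -mul2n expnM.
have := exp4_le_bin k; case: (odd t) => /=; last by rewrite add0n e4; nia.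
rewrite add1n expnS e4.
have : 'C(k.*2, k) <= 'C(k.*2.+1, k) by apply: leq_bin2l.
nia.
Qed.

Lemma bin_mul_exp_le d k : k <= d -> 'C(d, k) * 4 ^ (d - k) <= 5 ^ d.
Proof.
move=> kd; have := Pascal 4 1 d.
rewrite (bigD1 (Ordinal (kd : k < d.+1))) //= => ->.
by rewrite exp1n muln1 leq_addr.
Qed.

(** The largest of the [d.+1] terms of [(4 + 1) ^ d] is at least their average. *)
Lemma bin_heavy d : exists k, k.*2 <= d /\ 5 ^ d <= d.+1 * ('C(d, k) * 4 ^ (d - k)).
Proof.
pose F (i : 'I_d.+1) := 'C(d, i) * 4 ^ (d - i).
have [i _ iP] := @arg_maxnP _ ord0 predT F isT.
have h : 5 ^ d <= d.+1 * F i.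
  rewrite (Pascal 4 1 d) -[X in _ <= X * _]card_ord -sum_nat_const.
  by apply: leq_sum => j _; rewrite exp1n muln1; apply: iP.
have id : i <= d by rewrite -ltnS.
have [i2|i2] := leqP i.*2 d; first by exists i.
(* Reflecting an index above [d / 2] keeps the binomial and raises the power of 4. *)
exists (d - i); split; first lia.
apply: leq_trans h _; rewrite leq_mul2l bin_sub // /F leq_mul2l.
by rewrite leq_exp2l //; apply/orP; right; lia.
Qed.

(** Both sides count ordered pairs of disjoint [k]-subsets of a [d]-set; the proof compares
    factorials. *)
Lemma bin_double_exchange d k : k.*2 <= d ->
  'C(d, k.*2) * 'C(k.*2, k) = 'C(d, k) * 'C(d - k, k).
Proof.
move=> kd.
have k2 : k <= k.*2 by lia.
have k1 : k <= d by lia.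
have k3 : k <= d - k by lia.
have e2 : k.*2 - k = k by lia.
have e3 : d - k - k = d - k.*2 by lia.
have f1 := bin_fact kd.
have := bin_fact k2; rewrite e2 => f2.
have f3 := bin_fact k1.
have := bin_fact k3; rewrite e3 => f4.
have pos : 0 < k`! * k`! * (d - k.*2)`! by rewrite !muln_gt0 !fact_gt0.
apply/eqP; rewrite -(eqn_pmul2r pos); apply/eqP.
transitivity d`!; first by rewrite -f1 -f2; lia.
by rewrite -f3 -f4; lia.
Qed.

(** * Lower bound by double counting *)

Section LowerBound.
Variables (d : nat) (H : {ffun qvert d -> {set qvert d}}).
Hypothesis hubH : is_hub_labeling H.

Lemma pair_count_le k : k.*2 <= d ->
  2 ^ d * 'C(d, k.*2) <= 2 * ('C(d - k, k) * hl_size H).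
Proof.
move=> kd.
(* [far u v w] charges the pair to its endpoint [u]. Summed over ordered pairs, the two orientations
   contribute equally, whence the factor 2. *)
pose far u v w := [&& w \in H u, k <= qdist u w & on_geodesic u w v && (qdist u v == k.*2)].
have hcover u v : (qdist u v == k.*2 : nat) <= \sum_w (far u v w + far v u w).
  case: eqP => // dist.
  have /existsP[w /andP[]] := forallP (forallP hubH u) v.
  rewrite inE => /andP[wu wv] geo; rewrite (bigD1 w) //=.
  apply: leq_trans (leq_addr _ _).
  rewrite /far wu wv geo -on_geodesicC geo dist (qdistC v u) dist eqxx !andbT /=.
  move: geo; rewrite /on_geodesic dist (qdistC w v) => /eqP.
  by case: leqP; case: leqP => //=; lia.
have hfar : \sum_u \sum_v \sum_w far u v w <= 'C(d - k, k) * hl_size H.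
  rewrite /hl_size big_distrr /=; apply: leq_sum => u _.
  rewrite exchange_big /= -sum1_card big_distrr /= [X in _ <= X]big_mkcond.
  apply: leq_sum => w _; rewrite /far; case: (w \in H u); last by rewrite big1.
  rewrite muln1; case: (leqP k (qdist u w)) => kw; last by rewrite big1.
  apply: leq_trans (card_beyond kw kd).
  by rewrite -sum1dep_card [X in _ <= X]big_mkcond; apply: leq_sum => v _; case: ifP.
have -> : 2 ^ d * 'C(d, k.*2) = \sum_(u : qvert d) \sum_v (qdist u v == k.*2 : nat).
  rewrite -card_qvert -sum_nat_const; apply: eq_bigr => u _.
  rewrite -(card_sphere u) -sum1dep_card big_mkcond; apply: eq_bigr => v _.
  by case: eqP.
apply: (@leq_trans (\sum_u \sum_v \sum_w far u v w + \sum_u \sum_v \sum_w far v u w)).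
  rewrite -big_split; apply: leq_sum => u _.
  rewrite -big_split; apply: leq_sum => v _.
  by rewrite -big_split hcover.
rewrite [X in _ + X <= _]exchange_big /= addnn -mul2n leq_mul2l.
exact: hfar.
Qed.

Lemma hl_size_lower : 10 ^ d <= 2 * d.+1 * 4 ^ d * hl_size H.
Proof.
have [k [kd heavy]] := bin_heavy d.
have pc := pair_count_le kd; have ex := bin_double_exchange kd.
have pos : 0 < 'C(d - k, k) by rewrite bin_gt0; lia.
have small : 'C(k.*2, k) <= 4 ^ k by rewrite (_ : 4 = 2 ^ 2) // -expnM mul2n bin_le_exp2.
have key : 2 ^ d * 'C(d, k) <= 2 * (4 ^ k * hl_size H).
  (* Multiplying by ['C(d - k, k)] lets the exchange identity produce ['C(d, k.*2)], to which [pc]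
     applies; the factor then cancels. *)
  rewrite -(leq_pmul2r pos) -mulnA -ex.
  apply: leq_trans (_ : 2 * ('C(d - k, k) * hl_size H) * 'C(k.*2, k) <= _).
    by rewrite mulnA leq_mul2r pc orbT.
  by rewrite (_ : 2 * (4 ^ k * hl_size H) * 'C(d - k, k) = 
      2 * ('C(d - k, k) * hl_size H) * 4 ^ k) ?leq_mul2l ?small ?orbT //; lia.
have e4 : 4 ^ d = 4 ^ k * 4 ^ (d - k) by rewrite -expnD; congr (_ ^ _); lia.
rewrite (_ : 10 = 2 * 5) // expnMn e4.
apply: (@leq_trans (2 ^ d * (d.+1 * ('C(d, k) * 4 ^ (d - k))))).
  by rewrite leq_mul2l heavy orbT.
have := leq_mul (leqnn (d.+1 * 4 ^ (d - k))) key.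
nia.
Qed.
End LowerBound.

Lemma OPT_lower d : 10 ^ d <= 2 * d.+1 * 4 ^ d * OPT d.
Proof.
rewrite /OPT; elim/big_ind: _ => [|x y hx hy|H]; last exact: hl_size_lower.
  (* The default value of the minimum must obey the bound too: times [4 ^ d] it is [16 ^ d]. *)
  have : 10 ^ d <= 16 ^ d by case: d => // e; rewrite leq_exp2r.
  have -> : 16 ^ d = 4 ^ d * (2 ^ d) ^ 2 by rewrite -expnM (mulnC d) expnM -expnMn.
  by rewrite card_qvert; nia.
by rewrite /minn; case: ifP.
Qed.

(** * Greedy covering *)

Section GreedyCover.
Variables (E W : finType) (cov : E -> W -> bool) (c : nat).
Hypothesis cov_many : forall e, c <= #|[set w | cov e w]|.

Hypothesis W_gt0 : 0 < #|W|.

(** Averaging over [W]: the best [w] covers at least the mean number of elements of [U]. *)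
Lemma greedy_step (U : {set E}) :
  exists w, #|U| * c <= #|[set e in U | cov e w]| * #|W|.
Proof.
have dbl : #|U| * c <= \sum_w #|[set e in U | cov e w]|.
  rewrite -sum_nat_const.
  apply: (@leq_trans (\sum_(e in U) \sum_w cov e w)).
    apply: leq_sum => e _; apply: leq_trans (cov_many e) _.
    by rewrite -sum1dep_card big_mkcond; apply: leq_sum => w _; case: ifP.
  rewrite exchange_big; apply: leq_sum => w _.
  rewrite -sum1dep_card big_mkcond [X in _ <= X]big_mkcond.
  by apply: leq_sum => e _; case: (e \in U); case: (cov e w).
have [w0 _] := card_gt0P W_gt0.
have [w _ wP] := @arg_maxnP _ w0 predT (fun w => #|[set e in U | cov e w]|) isT.
exists w; apply: leq_trans dbl _.
by rewrite mulnC -sum_nat_const; apply: leq_sum => j _; apply: wP.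
Qed.

(** Each greedy choice shrinks the uncovered set by a factor [1 - c / #|W|]; denominators are
    cleared to stay in [nat]. *)
Lemma greedy_cover m :
  exists S : {set W}, #|S| <= m /\
    #|[set e | [forall w in S, ~~ cov e w]]| * #|W| ^ m <= #|E| * (#|W| - c) ^ m.
Proof.
elim: m => [|m [S [cS IH]]].
  by exists set0; rewrite cards0 !expn0 !muln1 max_card.
set U := [set e | _] in IH.
have [w wP] := greedy_step U.
exists (w |: S); split; first by rewrite cardsU1; case: (w \notin S); lia.
set U' := [set e | _].
have eU : #|U'| = #|U| - #|[set e in U | cov e w]|.
  rewrite -(cardsID [set e | cov e w] U) (_ : _ :&: _ = [set e in U | cov e w]).
    rewrite addKn; apply: eq_card => e; rewrite !inE.
    apply/forallP/andP => [h|[h1 /forallP h2] v].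
      split; first by have := h w; rewrite !inE eqxx.
      by apply/forallP=> v; apply/implyP=> vS; have := h v; rewrite !inE vS orbT.
    apply/implyP; rewrite !inE => /orP[/eqP -> //|]; exact: (implyP (h2 v)).
  by apply/setP=> e; rewrite !inE.
rewrite !expnS mulnA (mulnCA #|E|).
apply: (@leq_trans (#|U| * (#|W| - c) * #|W| ^ m)).
  by rewrite leq_mul2r eU; apply/orP; right; rewrite mulnBl mulnBr; lia.
by rewrite mulnAC mulnC leq_mul2l IH orbT.
Qed.

End GreedyCover.

(** By Bernoulli, [N ^ q] is at least [(N - c) ^ q + q * c * (N - c) ^ (q - 1)], and
    [q * c >= N - c] makes the second term at least the first. *)
Lemma bernoulli_double N c q : 0 < c -> c <= N -> N <= q * c -> 2 * (N - c) ^ q <= N ^ q.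
Proof.
case: q => [|q]; first by lia.
move=> c0 cN Nqc.
have bern x y n : (x ^ n + n * y * x ^ n.-1) <= (x + y) ^ n.
  elim: n => [|[|n] IH] //=; first by rewrite !expn1 expn0; lia.
  rewrite expnS; apply: leq_trans (leq_mul (leqnn (x + y)) IH).
  by rewrite /= !expnS; nia.
have := bern (N - c) c q.+1; rewrite subnK //=; apply: leq_trans.
rewrite expnS.
have : N * (N - c) ^ q <= q.+1 * c * (N - c) ^ q by rewrite leq_mul2r Nqc orbT.
have : (N - c) * (N - c) ^ q <= N * (N - c) ^ q by rewrite leq_mul2r leq_subr orbT.
lia.
Qed.

(** Each block of [q], about [#|W| / c], choices halves the uncovered set, so [l] blocks leave fewer
    than one element. *)
Lemma greedy_cover_full (E W : finType) (cov : E -> W -> bool) (c l : nat) :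
  0 < c -> 0 < #|W| -> c <= #|W| -> #|E| < 2 ^ l ->
  (forall e, c <= #|[set w | cov e w]|) ->
  exists S : {set W}, #|S| * c <= 2 * l * #|W| /\ forall e, exists2 w, w \in S & cov e w.
Proof.
move=> c0 W0 cW El many.
set q := (#|W| %/ c).+1.
have Nq : #|W| <= q * c by rewrite /q ltnW // -ltn_divLR.
have qN : q * c <= 2 * #|W|.
  by rewrite /q mulSn; have := leq_trunc_div #|W| c; lia.
have [S [cS SP]] := greedy_cover many W0 (q * l).
exists S; split.
  apply: (@leq_trans (q * l * c)); first by rewrite leq_mul2r cS orbT.
  by rewrite mulnAC -[2 * l * _]mulnAC leq_mul2r qN orbT.
set U := [set e | _] in SP.
have U0 : #|U| = 0.
  apply/eqP; rewrite -leqn0 -ltnS.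
  have Wp : 0 < #|W| ^ (q * l) by rewrite expn_gt0 W0.
  rewrite -(ltn_pmul2r Wp) mul1n.
  apply: leq_ltn_trans SP _.
  have dbl : 2 ^ l * (#|W| - c) ^ (q * l) <= #|W| ^ (q * l).
    by rewrite !expnM -expnMn; case: (l) => // l'; rewrite leq_exp2r // bernoulli_double.
  (* Strictness of [#|E| < 2 ^ l] survives multiplication only by a positive factor; a zero factor
     is settled directly. *)
  have [->|p] := posnP ((#|W| - c) ^ (q * l)); first by rewrite muln0.
  by apply: leq_trans dbl; rewrite ltn_pmul2r.
move=> e; have : e \notin U by rewrite (cards0_eq U0) inE.
rewrite inE negb_forall => /existsP[w].
by rewrite negb_imply negbK => /andP[wS ew]; exists w.
Qed.

Lemma card_bigcup_le (I T : finType) (F : I -> {set T}) :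
  #|\bigcup_i F i| <= \sum_i #|F i|.
Proof.
elim/big_rec2: _ => [|i n A _ IH]; first by rewrite cards0.
by rewrite cardsU (leq_trans (leq_subr _ _)) // leq_add2l.
Qed.

Lemma bigmin_le (I : finType) (P : pred I) (F : I -> nat) x0 i :
  P i -> \big[minn/x0]_(j | P j) F j <= F i.
Proof.
move=> Pi; have := mem_index_enum i; elim: (index_enum I) => // j s IH.
rewrite inE big_cons => /orP[/eqP <-|/IH h]; first by rewrite Pi geq_minl.
by case: ifP => // _; rewrite geq_min h orbT.
Qed.

(** * Upper bound from midpoint covers *)

Section UpperBound.
Variable d : nat.
Notation V := (qvert d).

Lemma midpoint_cover t : t <= d -> exists S : {set V},
  #|S| * 'C(t, t./2) <= 2 * d.*2.+1 * 2 ^ d /\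
  forall u v : V, qdist u v = t ->
    exists2 w, w \in S & on_geodesic u w v && (qdist u w == t./2).
Proof.
move=> td.
pose E := {p : V * V | qdist p.1 p.2 == t}.
pose cov (e : E) w := on_geodesic (val e).1 w (val e).2 && (qdist (val e).1 w == t./2).
have many e : 'C(t, t./2) <= #|[set w | cov e w]|.
  by rewrite card_geodesic (eqP (valP e)).
have c0 : 0 < 'C(t, t./2) by rewrite bin_gt0; lia.
(* There are at most [2 ^ d.*2] ordered pairs, so [l = d.*2.+1] gives the strict bound. *)
have [|||S [cS SP]] := @greedy_cover_full E V cov 'C(t, t./2) d.*2.+1 c0 _ _ _ many.
- by rewrite card_qvert expn_gt0.
- by rewrite card_qvert (leq_trans (bin_le_exp2 _ _)) // leq_exp2l.
- apply: (@leq_ltn_trans #|{: V * V}|).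
    by rewrite -(card_imset _ val_inj) max_card.
  by rewrite card_prod card_qvert -expnD addnn ltn_exp2l.
exists S; split; first by rewrite -card_qvert.
by move=> u v /eqP uv; apply: (SP (exist _ (u, v) uv)).
Qed.

(** Each binomial is bounded through one term of [(4 + 1) ^ d]; rounding down costs [2 ^ t] and
    rounding up at most twice that, hence the 3. *)
Lemma layer_cost t : t <= d ->
  4 ^ d * ('C(d, t./2) + 'C(d, uphalf t)) <= 3 * 2 ^ t * 5 ^ d.
Proof.
move=> td.
have bnd k : k <= d -> 4 ^ d * 'C(d, k) <= 5 ^ d * 4 ^ k.
  move=> kd; have := bin_mul_exp_le kd.
  have -> : 4 ^ d = 4 ^ (d - k) * 4 ^ k by rewrite -expnD subnK.
  nia.
have h1 : 4 ^ (t./2) <= 2 ^ t.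
  by rewrite (_ : 4 = 2 ^ 2) // -expnM leq_exp2l //; lia.
have h2 : 4 ^ (uphalf t) <= 2 * 2 ^ t.
  by rewrite (_ : 4 = 2 ^ 2) // -expnM -expnS leq_exp2l //; lia.
have b1 := bnd (t./2) ltac:(lia).
have b2 := bnd (uphalf t) ltac:(lia).
nia.
Qed.

Lemma OPT_upper : 4 ^ d * OPT d <= 24 * d.+1 ^ 3 * 10 ^ d.
Proof.
have [S SP] := fin_all_exists (fun t : 'I_d.+1 => midpoint_cover (leq_ord t)).
pose near (u : V) (t : 'I_d.+1) w := (qdist u w == t./2) || (qdist u w == uphalf t).
pose H : {ffun V -> {set V}} := [ffun u => \bigcup_t [set w in S t | near u t w]].
have hubH : is_hub_labeling H.
  apply/forallP=> u; apply/forallP=> v.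
  have lt : qdist u v < d.+1 by rewrite ltnS qdist_le.
  have [_ /(_ u v erefl) [w wS /andP[geo du]]] := SP (Ordinal lt).
  apply/existsP; exists w; rewrite inE geo andbT.
  move: (geo); rewrite /on_geodesic (eqP du) (qdistC w v) => /eqP/= dv.
  apply/andP; split; rewrite ffunE; apply/bigcupP; exists (Ordinal lt) => //;
    rewrite inE wS /near /=; first by rewrite du.
  apply/orP; right; apply/eqP. rewrite uphalf_half.
  by move: (odd_double_half (qdist u v)) dv; move: (qdist v w) (qdist u v)./2 (qdist u v) => x y z; lia.
apply: (@leq_trans (4 ^ d * hl_size H)); first by rewrite leq_mul2l bigmin_le ?orbT.
have size_le : hl_size H <= 
    \sum_(t < d.+1) #|S t| * ('C(d, t./2) + 'C(d, uphalf t)).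
  rewrite /hl_size.
  apply: (@leq_trans (\sum_u \sum_(t < d.+1) \sum_(w in S t) near u t w)).
    apply: leq_sum => u _; rewrite ffunE.
    apply: leq_trans (card_bigcup_le _) _.
    apply: leq_sum => t _; rewrite -sum1dep_card big_mkcondr /=.
    by apply: leq_sum => w _; case: ifP.
  (* Counting from the hub's side: [w] in [S t] serves only vertices on two spheres around it. *)
  rewrite exchange_big; apply: leq_sum => t _.
  rewrite exchange_big -sum_nat_const; apply: leq_sum => w _.
  rewrite -(card_sphere w) -(card_sphere w (uphalf t)) -!sum1dep_card.
  rewrite [X in _ <= X + _]big_mkcond [X in _ <= _ + X]big_mkcond -big_split.
  apply: leq_sum => u _; rewrite /near (qdistC u w).
  by case: eqP; case: eqP.
apply: leq_trans (leq_mul (leqnn _) size_le) _.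
rewrite big_distrr /=.
apply: (@leq_trans (\sum_(t < d.+1) 24 * d.+1 ^ 2 * 10 ^ d)); last first.
  by rewrite sum_nat_const card_ord !expnS; lia.
apply: leq_sum => t _; have [St _] := SP t.
have td : t <= d by rewrite -ltnS.
have lc := layer_cost td; have cen := exp2_le_bin_half t.
have St2 : #|S t| * 2 ^ t <= 4 * t.+1 * d.*2.+1 * 2 ^ d.
  have := leq_mul (leqnn #|S t|) cen.
  have := leq_mul (leqnn (2 * t.+1)) St; lia.
rewrite mulnCA; apply: leq_trans (leq_mul (leqnn _) lc) _.
rewrite (_ : 10 = 2 * 5) // expnMn.
apply: (@leq_trans (3 * (4 * t.+1 * d.*2.+1 * 2 ^ d) * 5 ^ d)).
  by rewrite mulnA leq_mul2r mulnCA leq_mul2l St2 !orbT.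
(* 12 is 3 from [layer_cost] times 4 from [St2]; [d.*2.+1 <= 2 * d.+1] doubles it to 24. *)
have poly : 12 * t.+1 * d.*2.+1 <= 24 * d.+1 ^ 2 by nia.
by have := leq_mul poly (leqnn (2 ^ d * 5 ^ d)); lia.
Qed.
End UpperBound.

(** * Passage to the limit of the roots *)

Open Scope R_scope.

Lemma is_lim_seq_ln_div_id : is_lim_seq (fun n => ln (INR n) / INR n) 0.
Proof.
apply: (is_lim_comp_seq (fun y => ln y / y) _ p_infty 0 is_lim_div_ln_p).
- by exists O.
- exact: is_lim_seq_INR.
Qed.

(** After taking logarithms, [ln (f n) / n] is within [(ln C + k * ln n) / n] of [ln b]; this error
    tends to 0 and [exp] is continuous. *)
Lemma is_lim_seq_root (f : nat -> R) (b C : R) (k : nat) :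
  0 < b -> 0 < C ->
  (forall n, (0 < n)%N -> b ^ n <= C * INR n ^ k * f n /\ f n <= C * INR n ^ k * b ^ n) ->
  is_lim_seq (fun n => Rpower (f n) (/ INR n)) b.
Proof.
move=> b0 C0 fP.
have err : is_lim_seq (fun n => ln C * / INR n + INR k * (ln (INR n) / INR n)) 0.
  rewrite -[0](_ : ln C * 0 + INR k * 0 = 0); last by ring.
  apply: is_lim_seq_plus'; apply: is_lim_seq_mult'; try exact: is_lim_seq_const.
    apply: (is_lim_seq_inv _ p_infty) => //; exact: is_lim_seq_INR.
  exact: is_lim_seq_ln_div_id.
rewrite -(exp_ln b b0); apply: is_lim_seq_continuous.
  exact: derivable_continuous_pt (derivable_pt_exp _).
apply: (is_lim_seq_le_le_loc
  (fun n => ln b - (ln C * / INR n + INR k * (ln (INR n) / INR n))) _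
  (fun n => ln b + (ln C * / INR n + INR k * (ln (INR n) / INR n)))).
- exists 1%N => n /leP n1.
  have [lo up] := fP n n1.
  have n0 : 0 < INR n by apply: lt_0_INR; apply/ltP.
  have p1 : 0 < INR n ^ k by apply: pow_lt.
  have p2 : 0 < b ^ n by apply: pow_lt.
  have p3 : 0 < C * INR n ^ k by apply: Rmult_lt_0_compat.
  have f0 : 0 < f n.
    by apply: (Rmult_lt_reg_l (C * INR n ^ k)) => //; rewrite Rmult_0_r; lra.
  have := ln_le _ _ p2 lo; have := ln_le _ _ f0 up.
  rewrite !ln_mult // !ln_pow //.
  move=> h1 h2.
  have e x : x = (INR n * x) * / INR n by field; lra.
  have i0 : 0 <= / INR n by left; apply: Rinv_0_lt_compat.
  rewrite (e (ln b)) /Rdiv; split.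
    have := Rmult_le_compat_r _ _ _ i0 h2; lra.
  have := Rmult_le_compat_r _ _ _ i0 h1; lra.
- rewrite -[X in is_lim_seq _ (Rbar.Finite X)](Rminus_0_r (ln b)).
  by apply: is_lim_seq_minus' => //; apply: is_lim_seq_const.
- rewrite -[X in is_lim_seq _ (Rbar.Finite X)](Rplus_0_r (ln b)).
  by apply: is_lim_seq_plus' => //; apply: is_lim_seq_const.
Qed.

Lemma INR_expn m n : INR (m ^ n)%N = INR m ^ n.
Proof. by elim: n => //= n IH; rewrite expnS mult_INR IH. Qed.

Lemma INR_leq m n : (m <= n)%N -> INR m <= INR n.
Proof. by move/leP/le_INR. Qed.

(* OPT(d) = (2.5 + o(1))^d, i.e. OPT(d)^(1/d) -> 5/2 as d -> infinity
   (OPT(d) >= 1, so the d-th root is well defined). *)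
Theorem mainTheorem5 :
  Un_cv (fun d : nat => Rpower (INR (OPT d)) (/ INR d)) (5 / 2).
Proof.
apply/is_lim_seq_Reals.
(* 192 is 24 times 8, from [(d + 1) ^ 3 <= 8 * d ^ 3] for positive [d]; the lower bound needs far
   less. *)
apply: (@is_lim_seq_root _ (5 / 2) 192 3); [lra | lra | move=> d d0].
have n1 : 1 <= INR d by have := INR_leq d0.
have n3 : (INR d + 1) ^ 3 <= 8 * INR d ^ 3.
  rewrite (_ : 8 * INR d ^ 3 = (2 * INR d) ^ 3); last by ring.
  by apply: pow_incr; lra.
have e : (5 / 2) ^ d * 4 ^ d = 10 ^ d by rewrite -Rpow_mult_distr; congr (_ ^ _); lra.
have p4 : 0 < 4 ^ d by apply: pow_lt; lra.
have p5 : 0 < (5 / 2) ^ d by apply: pow_lt; lra.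
have := INR_leq (OPT_lower d); have := INR_leq (OPT_upper d).
move: (OPT d) => opt; have o0 := pos_INR opt.
rewrite !(INR_expn, mult_INR) (S_INR d).
have [-> -> -> ->] : [/\ INR 10 = 10, INR 4 = 4, INR 2 = 2 & INR 24 = 24].
  by split; rewrite /=; lra.
rewrite -e => up lo; split.
- apply: (Rmult_le_reg_r (4 ^ d)) => //; apply: (Rle_trans _ _ _ lo).
  have q : 0 <= 4 ^ d * INR opt by apply: Rmult_le_pos => //; lra.
  have n13 : INR d + 1 <= 2 * INR d ^ 3 by have := pow_R1_Rle _ 2 n1; nra.
  have l : 2 * (INR d + 1) <= 192 * INR d ^ 3 by nra.
  have := Rmult_le_compat_r _ _ _ q l; lra.
- apply: (Rmult_le_reg_r (4 ^ d)) => //; rewrite Rmult_comm; apply: (Rle_trans _ _ _ up).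
  have q : 0 <= (5 / 2) ^ d * 4 ^ d by nra.
  have l : 24 * (INR d + 1) ^ 3 <= 192 * INR d ^ 3 by lra.
  have := Rmult_le_compat_r _ _ _ q l; lra.
Qed.
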